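(* There exists a universal constant $C>0$ such that the following holds. Let $n \ge 1$ and $d\ge 1$ be integers, let $P$ be a real polynomial of degree at most $d$ on $\{-1,1\}^n$, and let $X$ be uniformly distributed on $\{-1,1\}^n$. Then for every real $r \ge 1$, every $e^{-r}$-quantile $a_r$ of $P(X)$ and every $e^{-(r+1)}$-quantile $a_{r+1}$ of $P(X)$, $$ a_{r+1} - a_r \le C^d \left( \frac{r}{d} + 1 \right)^{\frac d2 - 1} \|P(X)\|_2 . $$
   Context: $X=(X_1,\ldots,X_n)$ has independent symmetric Bernoulli coordinates (each equal to $\pm1$ with probability $1/2$), i.e. $X$ is uniform on the discrete cube $\{-1,1\}^n$. A polynomial of degree at most $d$ on $\{-1,1\}^n$ is a function of the form $P(x)=\sum_{S\subseteq\{1,\ldots,n\},\ \#(S)\le d} a_S\prod_{i\in S}x_i$ with arbitrary real coefficients $a_S$. We write $\|P(X)\|_2=\sqrt{\mathbb{E}|P(X)|^2}$. For real $r>0$ (not necessarily an integer), an $e^{-r}$-quantile of $P(X)$ is a real number $a_r$ satisfying both $\mathbb{P}(P(X)\ge a_r)\ge e^{-r}$ and $\mathbb{P}(P(X)\le a_r)\ge 1-e^{-r}$. ''Universal constant'' means that $C$ does not depend on $n$, $d$, $P$, $r$ or the choice of quantiles. *)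

(* Defs.v *)
From HB Require Import structures.
From mathcomp Require Import all_boot all_order all_algebra.
From mathcomp Require Import reals sequences exp.

Set Implicit Arguments.
Unset Strict Implicit.
Unset Printing Implicit Defensive.

Import Order.TTheory GRing.Theory Num.Theory.
Local Open Scope ring_scope.

(* The discrete cube {-1,1}^n, with signs encoded as booleans:
   [false] stands for 1 and [true] for -1. *)
Definition cube (n : nat) : finType := {ffun 'I_n -> bool}.

Definition coord (R : realType) (n : nat) (x : cube n) (i : 'I_n) : R :=
  (-1) ^+ x i.

(* Probability and expectation for X uniform on the cube. *)
Definition Pr (R : realType) (n : nat) (E : pred (cube n)) : R :=
  #|[set x | E x]|%:R / #|cube n|%:R.

Definition Ex (R : realType) (n : nat) (f : cube n -> R) : R :=
  (\sum_(x : cube n) f x) / #|cube n|%:R.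

Definition norm2 (R : realType) (n : nat) (f : cube n -> R) : R :=
  Num.sqrt (Ex (fun x => `|f x| ^+ 2)).

Definition poly_deg_le (R : realType) (n d : nat) (P : cube n -> R) : Prop :=
  exists a : {set 'I_n} -> R, forall x : cube n,
    P x = \sum_(S : {set 'I_n} | (#|S| <= d)%N) a S * \prod_(i in S) coord R x i.

(* [a] is an e^{-r}-quantile of f(X); it need not be unique. *)
Definition is_quantile (R : realType) (n : nat) (f : cube n -> R) (r a : R)
    : Prop :=
  expR (- r) <= Pr R (fun x => a <= f x) /\
  1 - expR (- r) <= Pr R (fun x => f x <= a).

(* Main.v *)
From Pilot Require Import Defs.
From mathcomp Require Import all_boot all_order all_algebra.
From mathcomp Require Import reals sequences exp.
From mathcomp Require Import boolp ring lra zify.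

Import Order.TTheory GRing.Theory Num.Theory.
(* Brings the cube's [coord] back in front of the one of vector spaces. *)
Import Pilot.Defs.
Local Open Scope ring_scope.

(** The gap between the two quantiles is controlled by playing a functional
inequality for functions of small support against hypercontractivity of the
gradient.

Let [b <= c] be quantiles of levels [e^-r] and [e^-(r+1)], let [f = (P - b)_+],
and let [A = {P > b}], an event of probability at most [e^-r] that carries
[f].  Three facts are combined.

- Small support forces large energy ([faber_krahn]):
  [r * E f^2 <= 4 * sum_i E (D_i f)^2].  Since [f >= c - b] on [{P >= c}], the
  left side is at least [r * (c - b)^2 * e^-(r+1)].
- The energy of [f] lives near [A] ([positive_part_energy]):
  [E (D_i f)^2 <= 2 * E ((D_i P)^2 1_A)].  On the discrete cube an edge may
  leave [A], but each edge that contributes has an end in [A], which only costs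
  the factor 2.
- Up to a sign, [D_i P] is a polynomial of degree at most [d - 1], so its
  [2k]-norm is at most [(2k-1)^((d-1)/2)] times its 2-norm
  ([cube_deriv_hypercontractive]).  On an event of probability at most [e^-r]
  this gives [E ((D_i P)^2 1_A) <= 2 (2k-1)^(d-1) e^(r/k) e^-r ||D_i P||_2^2]
  ([cube_deriv_tail]).

The factors [e^-r] cancel, [sum_i ||D_i P||_2^2 <= d ||P||_2^2] because the
degree is at most [d], and what remains is
[r (c-b)^2 <= C (2k-1)^(d-1) e^(r/k) d ||P||_2^2] ([quantile_gap_sq]).  Taking
[k] close to [r/d + 1], rather than close to [r], makes [e^(r/k)] at most [e^d]
while [2k - 1 <= 2 (r/d + 1)], and this choice produces the power of [r/d + 1]
in place of a power of [r].

Both analytic inputs come from a single inequality ([bonami]):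
[E (sum_S a_S w_S)^(2k) <= (sum_S (2k-1)^|S| a_S^2)^k], where [w_S] are the
Walsh functions.  It is proved one coordinate at a time from Hoelder's
inequality and a comparison of binomial coefficients.  The functional
inequality is the dual of its case [k = 2]: it says that the noise operator
shrinks functions of small support, whereas a function of low energy has
its spectrum on small sets and is barely affected by noise. *)

(** * Elementary inequalities and identities *)

Section Elementary.
Context {R : realType}.

(** The AM-GM inequality for [i] copies of [u^(i+j)] and [j] copies of [v^(i+j)]. *)
Lemma weighted_AMGM (i j : nat) (u v : R) : (0 < i + j)%N -> 0 <= u -> 0 <= v ->
  (i + j)%:R * (u ^+ i * v ^+ j) <= i%:R * u ^+ (i + j) + j%:R * v ^+ (i + j).
Proof.
move=> k0 u0 v0; set k := (i + j)%N.
pose E (l : 'I_(i + j)) := match split l with inl _ => u ^+ k | inr _ => v ^+ k end.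
have E0 : {in [pred: 'I_(i + j) | true], forall l, 0 <= E l}.
  by move=> l _; rewrite /E; case: split => _; rewrite exprn_ge0.
have /= [+ _] := leif_AGM E0.
rewrite -/k !big_split_ord /= /E.
under eq_bigr => l _ do rewrite (unsplitK (inl l)).
under [X in _ * X]eq_bigr => l _ do rewrite (unsplitK (inr l)).
under [X in (X + _) / _]eq_bigr => l _ do rewrite (unsplitK (inl l)).
under [X in (_ + X) / _]eq_bigr => l _ do rewrite (unsplitK (inr l)).
rewrite !prodr_const !sumr_const card_ord !card_ord -!exprM ![(k * _)%N]mulnC !exprM -exprMn.
rewrite ler_pXn2r ?nnegrE ?mulr_ge0 ?exprn_ge0 ?addr_ge0 ?mulrn_wge0 ?exprn_ge0 ?invr_ge0 ?ler0n //.
by rewrite ler_pdivlMr ?ltr0n // mulrC !mulr_natl.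
Qed.

(** This comparison is what makes [2k - 1] the hypercontractive constant: it
dominates the even terms of [(x + y)^(2k)] by the terms of
[(x^2 + (2k-1) y^2)^k]. *)
Lemma bin_double_le (k j : nat) : ('C(k.*2, j.*2) <= 'C(k, j) * (k.*2.-1) ^ j)%N.
Proof.
case: k => [|k]; first by case: j => // j; rewrite bin0n.
elim: j => [|j IH]; first by rewrite !bin0.
set K := k.+1 in IH *.
have e1 : (j.+1 * 'C(K, j.+1) = (K - j) * 'C(K, j))%N by rewrite mul_bin_left.
have e2 : (j.*2.+1 * 'C(K.*2, j.*2.+1) = (K.*2 - j.*2) * 'C(K.*2, j.*2))%N by rewrite mul_bin_left.
have e3 : (j.*2.+2 * 'C(K.*2, j.*2.+2) = (K.*2 - j.*2.+1) * 'C(K.*2, j.*2.+1))%N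
  by rewrite mul_bin_left.
rewrite doubleS -(@leq_pmul2l (j.+1 * j.*2.+1)) // .
have -> : (j.+1 * j.*2.+1 * 'C(K.*2, j.*2.+2) =
           (K - j) * (K.*2 - j.*2.+1) * 'C(K.*2, j.*2))%N.
  apply/eqP; rewrite -(@eqn_pmul2l 2) //; apply/eqP.
  have -> : (2 * (j.+1 * j.*2.+1 * 'C(K.*2, j.*2.+2)) =
      j.*2.+1 * (j.*2.+2 * 'C(K.*2, j.*2.+2)))%N by rewrite (_ : j.*2.+2 = 2 * j.+1)%N; [ring | lia].
  rewrite e3 mulnCA e2 (_ : K.*2 - j.*2 = 2 * (K - j))%N; [ring | lia].
have -> : (j.+1 * j.*2.+1 * ('C(K, j.+1) * K.*2.-1 ^ j.+1) =
   (K - j) * (j.*2.+1 * K.*2.-1) * ('C(K, j) * K.*2.-1 ^ j))%N.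
  rewrite expnS; move: e1; move: (K - j)%N ('C(K, j.+1)) ('C(K, j)) (K.*2.-1) => p c c' q e1.
  transitivity (j.*2.+1 * (j.+1 * c) * q * q ^ j)%N; last rewrite e1; move: (q ^ j)%N => qj; ring.
apply: leq_mul => //; apply: leq_mul => //.
apply: (@leq_trans K.*2.-1); first by lia.
by rewrite leq_pmull.
Qed.

Lemma sum_even_odd (k : nat) (F : nat -> R) :
  \sum_(i < k.*2.+1) F i = \sum_(j < k.+1) F j.*2 + \sum_(j < k) F j.*2.+1.
Proof.
elim: k => [|k IH]; first by rewrite !big_ord_recr !big_ord0 /= !addr0.
rewrite doubleS !big_ord_recr /= in IH *.
by rewrite IH doubleS; ring.
Qed.

Lemma even_binomial (k : nat) (x y : R) :
  (x + y) ^+ k.*2 + (x - y) ^+ k.*2 =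
  2 * \sum_(j < k.+1) 'C(k.*2, j.*2)%:R * ((x ^+ 2) ^+ (k - j) * (y ^+ 2) ^+ j).
Proof.
rewrite !exprDn -big_split /=.
rewrite (sum_even_odd k (fun i => x ^+ (k.*2 - i) * y ^+ i *+ 'C(k.*2, i)
  + x ^+ (k.*2 - i) * (- y) ^+ i *+ 'C(k.*2, i))).
rewrite [X in _ + X]big1 ?addr0 => [|j _].
  rewrite mulr_sumr; apply: eq_bigr => j _.
  have -> : (- y) ^+ j.*2 = y ^+ j.*2 by rewrite -!mul2n !exprM sqrrN.
  by rewrite -!exprM !mul2n doubleB -mulr_natl; ring.
have -> : (- y) ^+ j.*2.+1 = - y ^+ j.*2.+1.
  by rewrite !exprS -!mul2n !exprM sqrrN mulNr.
by rewrite mulrN mulNrn subrr.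
Qed.

(** Trades the real exponent [d/2 - 1] for the integer exponent [d - 1] that
hypercontractivity produces. *)
Lemma powR_half_sqr (s : R) (d : nat) : 0 < s -> (0 < d)%N ->
  (s `^ (d%:R / 2 - 1)) ^+ 2 * s = s ^+ d.-1.
Proof.
move=> s0 d0; rewrite -powR_mulrn ?powR_ge0 // -powRrM -{2}(powRr1 (ltW s0)) -powRD; last first.
  by rewrite (gt_eqF s0) implybT.
rewrite -powR_mulrn ?ltW //; congr (_ `^ _).
by rewrite -[in LHS](prednK d0) -natr1; field.
Qed.

End Elementary.

(** * Expectation on the cube *)

Section Expectation.
Context {R : realType} {n : nat}.
Implicit Types (f g : cube n -> R) (x : cube n) (E : pred (cube n)).

Lemma card_cube_gt0 : 0 < #|cube n|%:R :> R.
Proof. by rewrite ltr0n; apply/card_gt0P; exists [ffun=> true]. Qed.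

Lemma eq_Ex f g : f =1 g -> Ex f = Ex g.
Proof. by move=> fg; rewrite /Ex; congr (_ / _); apply: eq_bigr. Qed.

Lemma ExD f g : Ex (fun x => f x + g x) = Ex f + Ex g.
Proof. by rewrite /Ex big_split mulrDl. Qed.

Lemma ExZ c f : Ex (fun x => c * f x) = c * Ex f.
Proof. by rewrite /Ex -mulr_sumr mulrA. Qed.

Lemma Ex_sum (I : Type) (s : seq I) (p : pred I) (F : I -> cube n -> R) :
  Ex (fun x => \sum_(i <- s | p i) F i x) = \sum_(i <- s | p i) Ex (F i).
Proof. by rewrite /Ex exchange_big mulr_suml. Qed.

Lemma Ex_cst (c : R) : Ex (fun _ : cube n => c) = c.
Proof.
by rewrite /Ex sumr_const -[c *+ _]mulr_natr mulfK // gt_eqF // card_cube_gt0.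
Qed.

Lemma ler_Ex f g : (forall x, f x <= g x) -> Ex f <= Ex g.
Proof.
by move=> fg; rewrite /Ex ler_pM2r ?invr_gt0 ?card_cube_gt0 // ler_sum.
Qed.

Lemma Ex_ge0 f : (forall x, 0 <= f x) -> 0 <= Ex f.
Proof. by move=> f0; rewrite -(Ex_cst 0); apply: ler_Ex. Qed.

Lemma Ex_le0_eq0 f : (forall x, 0 <= f x) -> Ex f <= 0 -> forall x, f x = 0.
Proof.
move=> f0 Ef x; have := Ef; rewrite /Ex pmulr_lle0 ?invr_gt0 ?card_cube_gt0 // => sf.
have /eqP : \sum_x f x == 0 by rewrite eq_le sf sumr_ge0.
by move=> /psumr_eq0P -> .
Qed.

Lemma Pr_Ex (E : pred (cube n)) : Pr R E = Ex (fun x => (E x)%:R).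
Proof.
rewrite /Pr /Ex; congr (_ / _).
by rewrite -sum1_card natr_sum big_mkcond; apply: eq_bigr => x _; rewrite inE; case: (E x).
Qed.

(** Hoelder's inequality, with upper bounds [A] and [B] in place of the norms of
[f] and [g], so that no root has to be taken: weighted AM-GM is applied to
[f / A] and [g / B] and then averaged. *)
Lemma holder (i j : nat) f g (A B : R) : (0 < i + j)%N -> 0 <= A -> 0 <= B ->
  (forall x, 0 <= f x) -> (forall x, 0 <= g x) ->
  Ex (fun x => f x ^+ (i + j)) <= A ^+ (i + j) ->
  Ex (fun x => g x ^+ (i + j)) <= B ^+ (i + j) ->
  Ex (fun x => f x ^+ i * g x ^+ j) <= A ^+ i * B ^+ j.
Proof.
move=> k0 A0 B0 f0 g0 fA gB.
case: i k0 fA gB => [|i] k0 fA gB.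
  by rewrite expr0 mul1r; apply: le_trans gB; apply: ler_Ex => x; rewrite expr0 mul1r.
case: j k0 fA gB => [|j] k0 fA gB.
  rewrite expr0 mulr1 -[X in A ^+ X]addn0; apply: le_trans fA.
  by apply: ler_Ex => x; rewrite addn0 expr0 mulr1.
have vanish (h : cube n -> R) (D : R) : (forall x, 0 <= h x) -> D = 0 ->
    Ex (fun x => h x ^+ (i.+1 + j.+1)) <= D ^+ (i.+1 + j.+1) -> forall x, h x = 0.
  move=> h0 ->; rewrite expr0n /= => /Ex_le0_eq0 h' x.
  by have /eqP := h' (fun y => exprn_ge0 _ (h0 y)) x; rewrite expf_eq0 => /andP[_ /eqP].
(* If a bound is zero then its function vanishes and both sides are zero. *)
case: (eqVneq A 0) => [A00|An0].
  rewrite A00 exprS !mul0r -(Ex_cst 0); apply: ler_Ex => x.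
  by rewrite (vanish f A) // exprS !mul0r.
case: (eqVneq B 0) => [B00|Bn0].
  rewrite B00 [0 ^+ _]exprS mul0r mulr0 -(Ex_cst 0); apply: ler_Ex => x.
  by rewrite (vanish g B) // [0 ^+ j.+1]exprS mul0r mulr0.
set k := (i.+1 + j.+1)%N in k0 fA gB *.
have Agt : 0 < A by rewrite lt_def An0.
have Bgt : 0 < B by rewrite lt_def Bn0.
have kgt : 0 < k%:R :> R by rewrite ltr0n.
pose c : R := A ^+ i.+1 * B ^+ j.+1 / k%:R.
have cge : 0 <= c by rewrite divr_ge0 ?mulr_ge0 ?exprn_ge0.
have step x : f x ^+ i.+1 * g x ^+ j.+1 <=
    c * (i.+1%:R / A ^+ k * f x ^+ k + j.+1%:R / B ^+ k * g x ^+ k).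
  have := weighted_AMGM i.+1 j.+1 (f x / A) (g x / B) k0.
  rewrite -/k !expr_div_n => /(_ (divr_ge0 (f0 x) A0) (divr_ge0 (g0 x) B0)) H.
  apply: le_trans (_ : c * (k%:R * (f x ^+ i.+1 / A ^+ i.+1 * (g x ^+ j.+1 / B ^+ j.+1))) <= _).
    rewrite le_eqVlt; apply/orP; left; apply/eqP; rewrite /c.
    by field; rewrite !expf_eq0 (negPf An0) (negPf Bn0) (gt_eqF kgt) !andbF.
  apply: ler_wpM2l => //; apply: le_trans H _.
  by rewrite le_eqVlt; apply/orP; left; apply/eqP; ring.
apply: le_trans (ler_Ex _ _ step) _.
rewrite ExZ ExD !ExZ.
apply: le_trans (_ : c * (i.+1%:R + j.+1%:R) <= _).
  apply: ler_wpM2l => //; apply: lerD; rewrite -mulrA ler_piMr // ?ler0n //.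
    by rewrite mulrC ler_pdivrMr ?exprn_gt0 // mul1r.
  by rewrite mulrC ler_pdivrMr ?exprn_gt0 // mul1r.
by rewrite -natrD -/k /c divfK ?gt_eqF.
Qed.

End Expectation.

(** * Walsh functions and discrete derivatives *)

Definition flip {n : nat} (i : 'I_n) (x : cube n) : cube n :=
  [ffun j => x j (+) (j == i)].

Definition walsh {R : realType} {n : nat} (S : {set 'I_n}) (x : cube n) : R :=
  \prod_(i in S) coord R x i.

Definition walsh_sum {R : realType} {n : nat} (a : {set 'I_n} -> R) (x : cube n) : R :=
  \sum_(S : {set 'I_n}) a S * walsh S x.

Definition fourier {R : realType} {n : nat} (f : cube n -> R) (S : {set 'I_n}) : R :=
  Ex (fun x => f x * walsh S x).

(** Dividing by 2 makes this the coefficient of [x_i], up to the sign [x_i] itself: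
it acts on the Walsh expansion by keeping the sets that contain [i]. *)
Definition cube_deriv {R : realType} {n : nat} (i : 'I_n) (f : cube n -> R) (x : cube n) : R :=
  (f x - f (flip i x)) / 2.

Section Walsh.
Context {R : realType} {n : nat}.
Implicit Types (f g : cube n -> R) (S T : {set 'I_n}) (a : {set 'I_n} -> R) (x : cube n).

Lemma flipK (i : 'I_n) : involutive (flip i).
Proof. by move=> x; apply/ffunP=> j; rewrite !ffunE -addbA addbb addbF. Qed.

Lemma Ex_flip (i : 'I_n) f : Ex (fun x => f (flip i x)) = Ex f.
Proof.
rewrite /Ex; congr (_ / _); rewrite [RHS](reindex_inj (inv_inj (flipK i))).
exact: eq_bigr.
Qed.

Lemma coord_flip (i j : 'I_n) x :
  coord R (flip i x) j = if j == i then - coord R x j else coord R x j.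
Proof.
by rewrite /coord ffunE; case: (j == i); rewrite ?addbT ?addbF //; case: (x j); rewrite ?expr1 ?expr0 ?opprK.
Qed.

Lemma coord_sqr (i : 'I_n) x : coord R x i ^+ 2 = 1.
Proof. by rewrite /coord -exprM mulnC exprM sqrrN !expr1n. Qed.

Lemma walsh_sqr S x : walsh S x ^+ 2 = 1 :> R.
Proof. by rewrite /walsh -prodrXl big1 // => i _; rewrite coord_sqr. Qed.

Lemma walshD1 S (i : 'I_n) x : i \in S ->
  walsh S x = coord R x i * walsh (S :\ i) x :> R.
Proof.
move=> iS; rewrite /walsh (bigD1 i) //=; congr (_ * _).
by apply: eq_bigl => j; rewrite !inE andbC.
Qed.

Lemma walsh_flip_notin S (i : 'I_n) x : i \notin S ->
  walsh S (flip i x) = walsh S x :> R.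
Proof.
move=> iS; apply: eq_bigr => j jS; rewrite coord_flip.
by case: eqP jS iS => // -> ->.
Qed.

Lemma walsh_flip S (i : 'I_n) x :
  walsh S (flip i x) = (if i \in S then - walsh S x else walsh S x) :> R.
Proof.
case: ifPn => iS; last exact: walsh_flip_notin.
by rewrite !(walshD1 _ _ _ iS) walsh_flip_notin ?setD11 // coord_flip eqxx mulNr.
Qed.

(** If [i] belongs to exactly one of [S] and [T], flipping the [i]-th
coordinate preserves the expectation and reverses its sign. *)
Lemma walsh_orthonormal S T :
  Ex (fun x => walsh S x * walsh T x : R) = (S == T)%:R.
Proof.
case: eqVneq => [->|neqST].
  by rewrite -[RHS](Ex_cst (n := n)); apply: eq_Ex => x; rewrite -expr2 walsh_sqr.
have [i iST] : exists i, (i \in S) != (i \in T).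
  apply/existsP; apply: contraNT neqST; rewrite negb_exists => /forallP H.
  by apply/eqP/setP => i; apply/eqP; have := H i; rewrite negbK.
set e := Ex _; suff : e = - e by move=> ?; rewrite mulr0n; lra.
rewrite {1}/e -(Ex_flip i) -mulN1r -ExZ; apply: eq_Ex => x.
rewrite !walsh_flip mulN1r.
by case: (i \in S) (i \in T) iST => [] [] //= _; rewrite ?mulrN ?mulNr.
Qed.

Lemma parseval a (b : {set 'I_n} -> R) :
  Ex (fun x => walsh_sum a x * walsh_sum b x) = \sum_S a S * b S.
Proof.
transitivity (\sum_S \sum_T a S * b T * Ex (fun x => walsh S x * walsh T x : R)).
  rewrite -(eq_Ex (fun x => \sum_S \sum_T a S * b T * (walsh S x * walsh T x))); last first.
    move=> x; rewrite /walsh_sum big_distrlr /=; apply: eq_bigr => S _.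
    by apply: eq_bigr => T _; ring.
  by rewrite Ex_sum; apply: eq_bigr => S _; rewrite Ex_sum; apply: eq_bigr => T _; rewrite ExZ.
apply: eq_bigr => S _; rewrite (bigD1 S) //= walsh_orthonormal eqxx mulr1.
by rewrite big1 ?addr0 // => T TS; rewrite walsh_orthonormal eq_sym (negPf TS) mulr0.
Qed.

(** Completeness of the Walsh system: the kernel [sum_S w_S(y) w_S(x)] factors
as [prod_i (1 + y_i x_i)], which vanishes unless [x = y]. *)
Lemma walsh_sum_fourier f : walsh_sum (fourier f) =1 f.
Proof.
move=> x.
transitivity (\sum_y f y / #|cube n|%:R * \sum_S walsh S y * walsh S x).
  rewrite /walsh_sum; under [RHS]eq_bigr => y _ do rewrite mulr_sumr.
  rewrite exchange_big /=; apply: eq_bigr => S _.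
  by rewrite /fourier /Ex mulrAC mulr_suml mulr_suml; apply: eq_bigr => y _; ring.
have kernel y : \sum_S walsh S y * walsh S x = (y == x)%:R * #|cube n|%:R :> R.
  transitivity (\prod_(i < n) (1 + coord R y i * coord R x i)).
    under [RHS]eq_bigr => i _ do rewrite addrC.
    rewrite bigA_distr /=; apply: eq_bigr => S _.
    by rewrite /walsh -big_split /= big_mkcond.
  case: eqVneq => [->|neq].
    rewrite mul1r card_ffun card_bool card_ord natrX -[n in RHS]card_ord -prodr_const.
    by apply: eq_bigr => i _; rewrite -expr2 coord_sqr.
  have [i yx] : exists i, y i != x i.
    apply/existsP; apply: contraNT neq; rewrite negb_exists => /forallP H.
    by apply/eqP/ffunP => i; apply/eqP; have := H i; rewrite negbK.
  rewrite mul0r (bigD1 i) //= [X in X * _](_ : _ = 0) ?mul0r //.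
  by rewrite /coord; case: (y i) (x i) yx => [] [] //= _; rewrite !expr0 !expr1; ring.
rewrite (bigD1 x) //= kernel eqxx mul1r divfK ?gt_eqF ?card_cube_gt0 //.
by rewrite big1 ?addr0 // => y yx; rewrite kernel (negPf yx) mul0r mulr0.
Qed.

Lemma cube_deriv_walsh_sum (i : 'I_n) a x :
  cube_deriv i (walsh_sum a) x = walsh_sum (fun S : {set _} => if i \in S then a S else 0) x.
Proof.
rewrite /cube_deriv /walsh_sum -sumrB mulr_suml; apply: eq_bigr => S _.
by rewrite walsh_flip; case: ifP => _; [field | rewrite subrr !mul0r].
Qed.

Lemma sum_split_mem (i : 'I_n) (F : {set 'I_n} -> R) :
  \sum_(S : {set _} | i \in S) F S = \sum_(S : {set 'I_n} | i \notin S) F (i |: S).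
Proof.
rewrite (reindex_onto (fun S : {set _} => i |: S) (fun S => S :\ i)) /=; last exact: setD1K.
apply: eq_bigl => S; rewrite setU11 /= .
apply/eqP/idP => [<-|]; [by rewrite setD11 | exact: setU1K].
Qed.

(** Neither of the two sums on the right depends on the [i]-th coordinate; the
second one is, up to the sign [x_i], the derivative in direction [i]. *)
Lemma walsh_sum_split (i : 'I_n) a x :
  walsh_sum a x = walsh_sum (fun S : {set _} => if i \in S then 0 else a S) x +
    coord R x i * walsh_sum (fun S : {set _} => if i \in S then 0 else a (i |: S)) x.
Proof.
rewrite /walsh_sum (bigID (fun S : {set 'I_n} => i \in S)) /= addrC; congr (_ + _).
  by rewrite big_mkcond; apply: eq_bigr => S _; case: (i \in S); rewrite //= mul0r.
rewrite sum_split_mem mulr_sumr big_mkcond; apply: eq_bigr => S _.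
case: (boolP (i \in S)) => iS /=; first by rewrite mul0r mulr0.
rewrite (walshD1 _ i) ?setU11 // setU1K //; ring.
Qed.

Lemma total_influence a :
  \sum_i Ex (fun x => cube_deriv i (walsh_sum a) x ^+ 2) = \sum_(S : {set 'I_n}) #|S|%:R * a S ^+ 2.
Proof.
transitivity (\sum_i \sum_(S : {set 'I_n}) (i \in S)%:R * a S ^+ 2).
  apply: eq_bigr => i _.
  rewrite (eq_Ex _ _ (fun x => congr1 (fun t => t ^+ 2) (cube_deriv_walsh_sum i a x))).
  by rewrite parseval; apply: eq_bigr => S _; case: ifP => _; rewrite ?mul1r ?mul0r.
rewrite exchange_big; apply: eq_bigr => S _.
by rewrite -mulr_suml -natr_sum -sum1_card -big_mkcond.
Qed.

Lemma cube_deriv_flip (i : 'I_n) f x : cube_deriv i f (flip i x) = - cube_deriv i f x.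
Proof. by rewrite /cube_deriv flipK; ring. Qed.

Lemma poly_deg_le_fourier (d : nat) f : poly_deg_le d f ->
  exists2 a : {set 'I_n} -> R, f =1 walsh_sum a & forall S, (d < #|S|)%N -> a S = 0.
Proof.
move=> [a fa]; exists (fun S : {set 'I_n} => if (#|S| <= d)%N then a S else 0).
  move=> x; rewrite fa big_mkcond; apply: eq_bigr => S _.
  by case: (#|S| <= d)%N; rewrite ?mul0r.
by move=> S; rewrite ltnNge => /negPf ->.
Qed.

Lemma norm2_walsh_sum a : norm2 (walsh_sum a) ^+ 2 = \sum_S a S ^+ 2.
Proof.
rewrite /norm2 sqr_sqrtr; last by apply: Ex_ge0 => x; exact: sqr_ge0.
rewrite (eq_Ex _ (fun x => walsh_sum a x * walsh_sum a x)); first by rewrite parseval.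
by move=> x; rewrite real_normK ?num_real.
Qed.

End Walsh.

(** * Hypercontractivity *)

Section Hypercontractivity.
Context {R : realType} {n : nat}.
Implicit Types (f g : cube n -> R) (S T : {set 'I_n}) (a : {set 'I_n} -> R)
  (x : cube n).

(** The two-point inequality, with [f] and [g] in place of scalars.  Averaging
over the sign [x_i] removes the odd terms of the binomial expansion, and each
remaining mixed moment is bounded by [holder]. *)
Lemma bonami_step (k : nat) (i : 'I_n) f g (A B : R) : (0 < k)%N ->
  (forall x, f (flip i x) = f x) -> (forall x, g (flip i x) = g x) ->
  0 <= A -> 0 <= B ->
  Ex (fun x => f x ^+ k.*2) <= A ^+ k -> Ex (fun x => g x ^+ k.*2) <= B ^+ k ->
  Ex (fun x => (f x + coord R x i * g x) ^+ k.*2) <= (A + k.*2.-1%:R * B) ^+ k.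
Proof.
move=> k0 fi gi A0 B0 fA gB.
have expand : Ex (fun x => (f x + coord R x i * g x) ^+ k.*2) =
  \sum_(j < k.+1) 'C(k.*2, j.*2)%:R * Ex (fun x => (f x ^+ 2) ^+ (k - j) * (g x ^+ 2) ^+ j).
  (* Flipping the sign [x_i] preserves the expectation. *)
  have sym : Ex (fun x => (f x - coord R x i * g x) ^+ k.*2) =
      Ex (fun x => (f x + coord R x i * g x) ^+ k.*2).
    by rewrite -[RHS](Ex_flip i); apply: eq_Ex => x; rewrite fi gi coord_flip eqxx mulNr.
  have : 2 * Ex (fun x => (f x + coord R x i * g x) ^+ k.*2) =
      2 * \sum_(j < k.+1) 'C(k.*2, j.*2)%:R * Ex (fun x => (f x ^+ 2) ^+ (k - j) * (g x ^+ 2) ^+ j).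
    rewrite mulrDl mul1r -{2}sym -ExD.
    rewrite (eq_Ex _ _ (fun x => even_binomial k (f x) (coord R x i * g x))).
    rewrite ExZ Ex_sum; congr (_ * _); apply: eq_bigr => j _; rewrite ExZ.
    by congr (_ * _); apply: eq_Ex => x; rewrite [(coord R x i * _) ^+ 2]exprMn coord_sqr mul1r.
  by apply: mulfI; rewrite pnatr_eq0.
rewrite expand exprDn; apply: ler_sum => j _.
have jk : (k - j + j = k)%N by rewrite subnK // -ltnS.
have H : Ex (fun x => (f x ^+ 2) ^+ (k - j) * (g x ^+ 2) ^+ j) <= A ^+ (k - j) * B ^+ j.
  apply: holder; rewrite ?jk //; try by move=> x; rewrite sqr_ge0.
  - by apply: le_trans fA; apply: ler_Ex => x; rewrite -exprM mul2n.
  - by apply: le_trans gB; apply: ler_Ex => x; rewrite -exprM mul2n.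
apply: le_trans (_ : ('C(k, j) * k.*2.-1 ^ j)%:R * (A ^+ (k - j) * B ^+ j) <= _).
  apply: ler_pM => //; last by rewrite ler_nat bin_double_le.
  by apply: Ex_ge0 => x; rewrite mulr_ge0 // exprn_ge0 // sqr_ge0.
by rewrite natrM natrX exprMn -mulr_natl le_eqVlt; apply/orP; left; apply/eqP; ring.
Qed.

(** Bonami's inequality, by induction on the number of coordinates on which the
function depends.  Keeping the weight [(2k-1)^|S|] inside the sum, rather than
bounding it by a power of the degree, lets one statement serve for polynomials
and, by duality, for arbitrary functions of small support. *)
Lemma bonami (k : nat) a : (0 < k)%N ->
  Ex (fun x => walsh_sum a x ^+ k.*2) <=
    (\sum_(S : {set 'I_n}) k.*2.-1%:R ^+ #|S| * a S ^+ 2) ^+ k.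
Proof.
move=> k0.
suff H (m : nat) T a' : #|T| = m -> (forall S, ~~ (S \subset T) -> a' S = 0) ->
  Ex (fun x => walsh_sum a' x ^+ k.*2) <=
    (\sum_(S : {set 'I_n}) k.*2.-1%:R ^+ #|S| * a' S ^+ 2) ^+ k.
  by apply: (H _ setT a erefl) => S; rewrite subsetT.
elim: m T a' => [|m IH] T b cT bT.
  have only0 S : S != set0 -> b S = 0.
    by move=> S0; apply: bT; move/eqP: cT; rewrite cards_eq0 => /eqP ->; rewrite subset0.
  rewrite (bigD1 set0) //= cards0 expr0 mul1r big1 ?addr0; last first.
    by move=> S /only0 ->; rewrite expr0n mulr0.
  rewrite -exprM mul2n -(Ex_cst (n := n) (b set0 ^+ _)); apply: ler_Ex => x.
  rewrite /walsh_sum (bigD1 set0) //= big1 ?addr0; last by move=> S /only0 ->; rewrite mul0r.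
  by rewrite /walsh big_set0 mulr1.
have /card_gt0P[i iT] : (0 < #|T|)%N by rewrite cT.
set a0 := fun S : {set 'I_n} => if i \in S then 0 else b S.
set a1 := fun S : {set 'I_n} => if i \in S then 0 else b (i |: S).
have cT' : #|T :\ i| = m by have := cardsD1 i T; rewrite iT cT add1n => -[].
have inv (c : {set 'I_n} -> R) x :
    walsh_sum (fun S : {set 'I_n} => if i \in S then 0 else c S) (flip i x) =
    walsh_sum (fun S : {set 'I_n} => if i \in S then 0 else c S) x.
  apply: eq_bigr => S _; case: ifPn; first by rewrite !mul0r.
  by move=> iS; rewrite walsh_flip_notin.
have H0 : Ex (fun x => walsh_sum a0 x ^+ k.*2) <=
    (\sum_(S : {set 'I_n}) k.*2.-1%:R ^+ #|S| * a0 S ^+ 2) ^+ k.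
  apply: (IH (T :\ i)) => // S; rewrite subsetD1 negb_and negbK /a0.
  by case: (i \in S); rewrite ?orbT // orbF => /bT.
have H1 : Ex (fun x => walsh_sum a1 x ^+ k.*2) <=
    (\sum_(S : {set 'I_n}) k.*2.-1%:R ^+ #|S| * a1 S ^+ 2) ^+ k.
  apply: (IH (T :\ i)) => // S; rewrite subsetD1 negb_and negbK /a1.
  case: (i \in S) => //; rewrite orbF => ST; apply: bT; apply: contra ST.
  by apply: subset_trans; apply: subsetUr.
have nn (c : {set 'I_n} -> R) : 0 <= \sum_(S : {set 'I_n}) k.*2.-1%:R ^+ #|S| * c S ^+ 2.
  by apply: sumr_ge0 => S _; rewrite mulr_ge0 ?sqr_ge0 // exprn_ge0.
have := bonami_step _ i _ _ _ _ k0 (inv b) (inv (fun S => b (i |: S))) (nn _) (nn _) H0 H1.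
rewrite (eq_Ex _ (fun x => walsh_sum b x ^+ k.*2)); last by move=> x; rewrite (walsh_sum_split i b).
move/le_trans; apply; rewrite ler_pXn2r ?nnegrE ?addr_ge0 ?mulr_ge0 ?nn //.
rewrite [leRHS](bigID (fun S : {set 'I_n} => i \in S)) /= sum_split_mem [leRHS]addrC; apply: lerD; last first.
  rewrite mulr_sumr [leRHS]big_mkcond; apply: ler_sum => S _; rewrite /a1.
  case: (boolP (i \in S)) => iS /=; first by rewrite expr0n !mulr0.
  by rewrite cardsU1 iS add1n [k.*2.-1%:R ^+ #|S|.+1]exprS mulrA.
rewrite [leRHS]big_mkcond; apply: ler_sum => S _; rewrite /a0.
by case: (i \in S) => //=; rewrite expr0n !mulr0.
Qed.

(** The exponent is [d - 1] and not [d], because the factor [x_i] of the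
derivative disappears in an even power; the final exponent [d/2 - 1] depends
on this gain. *)
Lemma cube_deriv_hypercontractive (k d : nat) (i : 'I_n) a : (0 < k)%N -> (0 < d)%N ->
  (forall S, (d < #|S|)%N -> a S = 0) ->
  Ex (fun x => cube_deriv i (walsh_sum a) x ^+ k.*2) <=
    (k.*2.-1%:R ^+ d.-1 * \sum_(S : {set 'I_n} | i \in S) a S ^+ 2) ^+ k.
Proof.
move=> k0 d0 ad.
set b := fun S : {set 'I_n} => if i \in S then 0 else a (i |: S).
rewrite (eq_Ex _ (fun x => walsh_sum b x ^+ k.*2)); last first.
  move=> x; rewrite cube_deriv_walsh_sum (walsh_sum_split i).
  rewrite [X in X + _](_ : _ = 0) ?add0r; last first.
    by rewrite /walsh_sum big1 // => S _; case: (i \in S); rewrite mul0r.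
  rewrite -mul2n exprM [(coord R x i * _) ^+ 2]exprMn coord_sqr mul1r -exprM.
  by congr (_ ^+ _); apply: eq_bigr => S _; rewrite setU11.
apply: le_trans (bonami k b k0) _.
have nn : 0 <= k.*2.-1%:R :> R by [].
rewrite ler_pXn2r ?nnegrE //; last 2 first.
- by apply: sumr_ge0 => S _; apply: mulr_ge0; [exact: exprn_ge0 | exact: sqr_ge0].
- by apply: mulr_ge0; [exact: exprn_ge0 | apply: sumr_ge0 => S _; exact: sqr_ge0].
rewrite sum_split_mem mulr_sumr [leRHS]big_mkcond; apply: ler_sum => S _; rewrite /b.
case: (boolP (i \in S)) => iS /=; first by rewrite expr0n mulr0.
case: (leqP #|i |: S| d) => dS; last by rewrite ad // expr0n !mulr0.
apply: ler_wpM2r; rewrite ?sqr_ge0 // ler_weXn2l //.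
  by rewrite ler1n; lia.
by rewrite cardsU1 iS add1n in dS; rewrite -ltnS prednK.
Qed.

End Hypercontractivity.

(** * Functions of small support *)

Section SmallSupport.
Context {R : realType} {n : nat}.
Implicit Types (f g : cube n -> R) (S : {set 'I_n})
  (x : cube n) (E : pred (cube n)).

(** The left side is [N = E (f * g)], where [g] is [f] with its spectrum damped by
[3^-|S|].  As [f] is carried by the event [E], two applications of Cauchy-Schwarz bring in
[E g^4] and the probability of that event, and [bonami] with [k = 2] bounds [E g^4] by
[N^2]; the powers of [N] then cancel. *)
Lemma noise_small_support f E (p : R) : 0 <= p ->
  (forall x, ~~ E x -> f x = 0) -> Pr R E <= p ^+ 4 ->
  \sum_(S : {set 'I_n}) (3^-1) ^+ #|S| * fourier f S ^+ 2 <= Ex (fun x => f x ^+ 2) * p ^+ 2.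
Proof.
move=> p0 fE PE; set N := \sum_S _.
pose b S : R := (3^-1) ^+ #|S| * fourier f S.
have N0 : 0 <= N.
  by apply: sumr_ge0 => S _; apply: mulr_ge0; [apply: exprn_ge0; lra | exact: sqr_ge0].
have f20 : 0 <= Ex (fun x => f x ^+ 2) by apply: Ex_ge0 => x; exact: sqr_ge0.
have g4 : Ex (fun x => (walsh_sum b x ^+ 2) ^+ 2) <= N ^+ 2.
  rewrite (eq_Ex _ (fun x => walsh_sum b x ^+ 2.*2)); last by move=> x; rewrite -exprM.
  rewrite [N](_ : _ = \sum_(S : {set 'I_n}) 2.*2.-1%:R ^+ #|S| * b S ^+ 2); first exact: bonami.
  apply: eq_bigr => S _; rewrite /b /=.
  have -> : 3%:R ^+ #|S| = (3^-1 ^+ #|S|)^-1 :> R by rewrite exprVn invrK.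
  by field; rewrite exprVn invr_eq0 expf_eq0 pnatr_eq0 andbF.
have ind E' : Ex (fun x => (E' x)%:R ^+ 2 : R) = Pr R E'.
  by rewrite Pr_Ex; apply: eq_Ex => x; case: (E' x); rewrite ?expr1n ?expr0n.
have g2 : Ex (fun x => (walsh_sum b x ^+ 2) * (E x)%:R) <= N * p ^+ 2.
  apply: (holder 1 1 (fun x => walsh_sum b x ^+ 2) (fun x => (E x)%:R) N (p ^+ 2)) => //.
  - exact: exprn_ge0.
  - by move=> x; exact: sqr_ge0.
  - by rewrite ind -exprM.
have fg : Ex (fun x => f x * walsh_sum b x) = N.
  rewrite (eq_Ex _ (fun x => walsh_sum (fourier f) x * walsh_sum b x)); last first.
    by move=> x; rewrite walsh_sum_fourier.
  by rewrite parseval; apply: eq_bigr => S _; rewrite /b expr2; ring.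
have : N <= Num.sqrt (Ex (fun x => f x ^+ 2)) * Num.sqrt (N * p ^+ 2).
  rewrite -{1}fg.
  apply: le_trans (_ : Ex (fun x => `|f x| ^+ 1 * `|walsh_sum b x * (E x)%:R| ^+ 1) <= _).
    apply: ler_Ex => x; rewrite !expr1 -normrM.
    case: (boolP (E x)) => [Ex|/fE ->]; first by rewrite mulr1 ler_norm.
    by rewrite !mul0r normr0.
  apply: (holder 1 1); rewrite ?sqrtr_ge0 //.
    rewrite sqr_sqrtr // ; apply: ler_Ex => x; by rewrite real_normK ?num_real.
  rewrite sqr_sqrtr ?mulr_ge0 ?sqr_ge0 //; apply: le_trans g2; apply: ler_Ex => x.
  by rewrite real_normK ?num_real // exprMn; case: (E x); rewrite ?expr1n ?expr0n.
rewrite -sqrtrM // => H.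
case: (eqVneq N 0) => [->|N1]; first by rewrite mulr_ge0 ?sqr_ge0.
have Np : 0 < N by rewrite lt_def N1.
rewrite -(ler_pM2l Np) -expr2.
apply: le_trans (_ : Num.sqrt (Ex (fun x => f x ^+ 2) * (N * p ^+ 2)) ^+ 2 <= _).
  by rewrite ler_pXn2r ?nnegrE ?sqrtr_ge0.
rewrite sqr_sqrtr; first by rewrite mulrCA.
by apply: mulr_ge0 => //; apply: mulr_ge0 => //; exact: sqr_ge0.
Qed.

(** The energy is [sum_S |S| fhat(S)^2], and [3^-|S| >= e^(-2|S|)] lies above the
tangent line of the exponential at [-r/2].  This bounds the damped sum of
[noise_small_support] from below by an affine function of the energy, and the
upper bound [e^(-r/2) E f^2] forces the energy to be large. *)
Lemma faber_krahn f E (r : R) : 0 <= r ->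
  (forall x, ~~ E x -> f x = 0) -> Pr R E <= expR (- r) ->
  r * Ex (fun x => f x ^+ 2) <= 4 * \sum_i Ex (fun x => cube_deriv i f x ^+ 2).
Proof.
move=> r0 fE PE.
have -> : \sum_i Ex (fun x => cube_deriv i f x ^+ 2) = \sum_(S : {set 'I_n}) #|S|%:R * fourier f S ^+ 2.
  rewrite -total_influence; apply: eq_bigr => i _; apply: eq_Ex => x.
  by rewrite /cube_deriv !walsh_sum_fourier.
have Ef : Ex (fun x => f x ^+ 2) = \sum_S fourier f S ^+ 2.
  rewrite (eq_Ex _ (fun x => walsh_sum (fourier f) x * walsh_sum (fourier f) x)).
    by rewrite parseval; apply: eq_bigr => S _; rewrite expr2.
  by move=> x; rewrite walsh_sum_fourier expr2.
have := noise_small_support f E (expR (- r / 4)) (expR_ge0 _) fE.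
rewrite -!expRM_natl [4 * _](_ : _ = - r); last by field.
rewrite [2 * _](_ : _ = - (r / 2)); last by field.
move=> /(_ PE) H.
set W := Ex _ in Ef H *; set I := \sum_S _.
(* The tangent line bound, summed against [fhat(S)^2]. *)
have lower : expR (- (r / 2)) * ((1 + r / 2) * W - 2 * I) <=
    \sum_(S : {set 'I_n}) (3^-1) ^+ #|S| * fourier f S ^+ 2.
  rewrite Ef /I !mulr_sumr -sumrB mulr_sumr; apply: ler_sum => S _.
  rewrite [leLHS](_ : _ = expR (- (r / 2)) * (1 + (r / 2 - 2 * #|S|%:R)) * fourier f S ^+ 2); last by ring.
  apply: ler_wpM2r; first exact: sqr_ge0.
  apply: le_trans (_ : expR (- (r / 2)) * expR (r / 2 - 2 * #|S|%:R) <= _).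
    by apply: ler_wpM2l; [exact: expR_ge0 | exact: expR_ge1Dx].
  rewrite -expRD [_ + _](_ : _ = #|S|%:R * - 2); last by ring.
  rewrite expRM_natl; apply: lerXn2r; rewrite ?nnegrE ?expR_ge0 ?invr_ge0 //.
  rewrite expRN lef_pV2 ?posrE ?expR_gt0 //.
  by apply: le_trans (expR_ge1Dx _); lra.
have := le_trans lower H; rewrite mulrC ler_pM2r ?expR_gt0 //.
lra.
Qed.

End SmallSupport.

(** * Energy of a polynomial above a quantile *)

Section QuantileGap.
Context {R : realType} {n : nat}.
Implicit Types (f g : cube n -> R) (S T : {set 'I_n}) (a : {set 'I_n} -> R)
  (x : cube n) (E : pred (cube n)).

(** On [E], [g] is at most [t + g^k / t^(k-1)].  The hypotheses on [M] and on
the probability of [E] make each of the two terms contribute at most [t * q]. *)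
Lemma truncated_tail_moment (k : nat) g E (M t q : R) : (0 < k)%N -> 0 < t -> 0 <= q ->
  (forall x, 0 <= g x) -> Ex (fun x => g x ^+ k) <= M ^+ k -> M ^+ k <= t ^+ k * q ->
  Pr R E <= q -> Ex (fun x => g x * (E x)%:R) <= 2 * t * q.
Proof.
case: k => // k _ t0 q0 g0 gM Mt PE.
have tk : 0 < t ^+ k by rewrite exprn_gt0.
rewrite -(ler_pM2l tk) -ExZ.
apply: le_trans (_ : Ex (fun x => g x ^+ k.+1 + t ^+ k.+1 * (E x)%:R) <= _).
  apply: ler_Ex => x; case: (E x); rewrite ?mulr1 ?mulr0 ?addr0 ?exprn_ge0 //.
  have gk : 0 <= g x ^+ k by rewrite exprn_ge0.
  rewrite !exprS; case: (lerP (g x) t) => gt.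
    by rewrite [t * _]mulrC; have := mulr_ge0 (g0 x) gk; have := ler_wpM2l (ltW tk) gt; lra.
  have := lerXn2r k (ltW t0 : t \in Num.nneg) (g0 x : g x \in Num.nneg) (ltW gt).
  move=> /(ler_wpM2l (g0 x)); have := mulr_ge0 (ltW t0) (ltW tk); lra.
rewrite ExD ExZ -Pr_Ex.
have : t ^+ k.+1 * Pr R E <= t ^+ k.+1 * q by apply: ler_wpM2l => //; apply: exprn_ge0; exact: ltW.
have := le_trans gM Mt; rewrite !exprS; lra.
Qed.

(** Taking the positive part of [f - c] is a contraction that kills every edge
with both ends in [{f <= c}]; an edge with an end in [{c < f}] is charged to
that end, and is counted from both ends by flip invariance. *)
Lemma positive_part_energy (i : 'I_n) f (c : R) :
  Ex (fun x => cube_deriv i (fun y => Num.max (f y - c) 0) x ^+ 2) <=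
  2 * Ex (fun x => cube_deriv i f x ^+ 2 * (c < f x)%R%:R).
Proof.
set h := fun x => cube_deriv i f x ^+ 2 * (c < f x)%R%:R.
apply: le_trans (_ : Ex (fun x => h x + h (flip i x)) <= _); last first.
  by rewrite ExD Ex_flip; lra.
apply: ler_Ex => x; rewrite /h cube_deriv_flip sqrrN -mulrDr /cube_deriv.
set u := f x; set v := f (flip i x).
have sq (s t : R) : 0 <= s <= t -> s ^+ 2 <= t ^+ 2 by move=> ?; nra.
case: (ltrP c u) => cu; case: (ltrP c v) => cv; rewrite /= ?mulr0n ?mulr1n.
- rewrite !max_l; [ | lra | lra]. have := sqr_ge0 ((u - v) / 2); nra.
- rewrite max_l ?max_r; [ | lra | lra]. have := sq ((u - c - 0) / 2) ((u - v) / 2); lra.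
- rewrite max_r ?max_l; [ | lra | lra]. have := sq ((v - c - 0) / 2) ((v - u) / 2); nra.
- by rewrite !max_r; [ | lra | lra]; lra.
Qed.

(** Here [truncated_tail_moment] is used at the threshold
[(2k-1)^(d-1) e^(r/k) ||D_i P||_2^2]. *)
Lemma cube_deriv_tail (d k : nat) (r : R) (i : 'I_n) a E : (0 < d)%N -> (0 < k)%N ->
  (forall S, (d < #|S|)%N -> a S = 0) -> Pr R E <= expR (- r) ->
  Ex (fun x => cube_deriv i (walsh_sum a) x ^+ 2 * (E x)%:R) <=
  2 * (k.*2.-1%:R ^+ d.-1 * expR (r / k%:R) * \sum_(S : {set 'I_n} | i \in S) a S ^+ 2) * expR (- r).
Proof.
move=> d0 k0 ad PE; set W := \sum_(S | _) _.
have W0 : 0 <= W by apply: sumr_ge0 => S _; exact: sqr_ge0.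
have K0 : 0 < k.*2.-1%:R ^+ d.-1 :> R by apply: exprn_gt0; rewrite ltr0n; lia.
have mom : Ex (fun x => (cube_deriv i (walsh_sum a) x ^+ 2) ^+ k) <= (k.*2.-1%:R ^+ d.-1 * W) ^+ k.
  apply: le_trans (cube_deriv_hypercontractive k d i a k0 d0 ad).
  by apply: ler_Ex => x; rewrite -exprM mul2n.
have D0 x : 0 <= cube_deriv i (walsh_sum a) x ^+ 2 by exact: sqr_ge0.
(* A zero threshold is excluded below; here the derivative vanishes identically. *)
case: (eqVneq W 0) => [Weq|Wn0].
  move: mom; rewrite Weq !mulr0 mul0r expr0n (gtn_eqF k0) /=.
  move=> /(Ex_le0_eq0 _ (fun x => exprn_ge0 k (D0 x))) z.
  rewrite -(Ex_cst (n := n) 0); apply: ler_Ex => x.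
  by have /eqP := z x; rewrite expf_eq0 k0 => /eqP ->; rewrite mul0r.
have Wgt : 0 < W by rewrite lt_def Wn0.
apply: (truncated_tail_moment k _ _ _ _ _ k0 _ (expR_ge0 _) D0 mom) => //.
  by rewrite !mulr_gt0 ?expR_gt0.
rewrite mulrAC [X in _ <= X * _]exprMn -[leRHS]mulrA -expRM_natl -expRD.
by rewrite [_ + _](_ : _ = 0) ?expR0 ?mulr1 //; field; rewrite pnatr_eq0 -lt0n.
Qed.

(** The exponent [k] is left free; the theorem is the case [k = floor(r/d) + 1]. *)
Lemma quantile_gap_sq (d k : nat) (r b c : R) a : (0 < d)%N -> (0 < k)%N -> 0 <= r -> b <= c ->
  (forall S, (d < #|S|)%N -> a S = 0) ->
  is_quantile (walsh_sum a) r b -> is_quantile (walsh_sum a) (r + 1) c ->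
  r * (c - b) ^+ 2 <= 16 * expR 1 * (k.*2.-1%:R ^+ d.-1 * expR (r / k%:R)) *
    (d%:R * \sum_S a S ^+ 2).
Proof.
move=> d0 k0 r0 bc ad [_ qb] [qc _].
set P := walsh_sum a in qb qc *; set f := fun x => Num.max (P x - b) 0.
set E : pred (cube n) := fun x => b < P x.
have PE : Pr R E <= expR (- r).
  (* The quantile condition from above bounds [P > b] by complementation. *)
  suff : Pr R E + Pr R (fun x => P x <= b) = 1 by lra.
  rewrite !Pr_Ex -ExD -[RHS](Ex_cst (n := n)); apply: eq_Ex => x.
  by rewrite /E ltNge; case: (P x <= b); rewrite /= ?addr0 ?add0r.
have fE x : ~~ E x -> f x = 0 by rewrite /E -leNgt => h; rewrite /f max_r //; lra.
set K := k.*2.-1%:R ^+ d.-1 * expR (r / k%:R).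
have K0 : 0 <= K by rewrite mulr_ge0 ?expR_ge0 ?exprn_ge0.
have energy : \sum_i Ex (fun x => cube_deriv i f x ^+ 2) <=
    4 * K * expR (- r) * (d%:R * \sum_S a S ^+ 2).
  apply: le_trans (_ : \sum_i (4 * K * expR (- r) * \sum_(S : {set 'I_n} | i \in S) a S ^+ 2) <= _).
    apply: ler_sum => i _; apply: le_trans (positive_part_energy i P b) _.
    have := cube_deriv_tail d k r i a E d0 k0 ad PE; rewrite -/K -/P /E; lra.
  rewrite -mulr_sumr; apply: ler_wpM2l.
    by apply: mulr_ge0; [exact: mulr_ge0 | exact: expR_ge0].
  rewrite (exchange_big_dep predT) //= mulr_sumr; apply: ler_sum => S _.
  rewrite sumr_const -[leLHS]mulr_natl.
  case: (leqP #|S| d) => dS; last by rewrite ad // expr0n /= !mulr0.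
  by apply: ler_wpM2r; rewrite ?sqr_ge0 // ler_nat.
have low : (c - b) ^+ 2 * expR (- (r + 1)) <= Ex (fun x => f x ^+ 2).
  apply: le_trans (_ : (c - b) ^+ 2 * Pr R (fun x => c <= P x) <= _).
    by apply: ler_wpM2l; first exact: sqr_ge0.
  rewrite Pr_Ex -ExZ; apply: ler_Ex => x.
  case: (lerP c (P x)) => cP /=; last by rewrite mulr0 sqr_ge0.
  by rewrite mulr1 /f max_l; [nra | lra].
have FK := faber_krahn f E r r0 fE PE.
have := le_trans (ler_wpM2l r0 low) FK.
have -> : expR (- (r + 1)) = expR (- r) * (expR 1)^-1 by rewrite -expRN -expRD opprD.
move=> H; have {H energy} := le_trans H (ler_wpM2l (ler0n _ 4) energy).
have := expR_gt0 (- r); have := expR_gt0 (1 : R).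
set e := expR 1; set q := expR (- r) => e0 q0.
rewrite [leLHS](_ : _ = q / e * (r * (c - b) ^+ 2)); last by ring.
rewrite -ler_pdivlMl ?divr_gt0 // => /le_trans; apply.
by rewrite le_eqVlt; apply/orP; left; apply/eqP; field; rewrite !gt_eqF.
Qed.

End QuantileGap.

Theorem proposition1 (R : realType) :
  exists C : R, 0 < C /\
    forall (n d : nat), (1 <= n)%N -> (1 <= d)%N ->
    forall P : cube n -> R, poly_deg_le d P ->
    forall r : R, 1 <= r ->
    forall a b : R, is_quantile P r a -> is_quantile P (r + 1) b ->
      b - a <= C ^+ d * (r / d%:R + 1) `^ (d%:R / 2 - 1) * norm2 P.
Proof.
exists (8 * expR 1); split; first by rewrite mulr_gt0 ?expR_gt0.
move=> n d _ d1 P /poly_deg_le_fourier[w Pw wd] r r1 a b.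
have -> : P = walsh_sum w by apply: funext.
move=> qa qb.
have d0 : 0 < d%:R :> R by rewrite ltr0n.
set s := r / d%:R + 1.
have rd0 : 0 <= r / d%:R by apply: divr_ge0; [lra | exact: ltW].
have s0 : 0 < s by rewrite /s; lra.
set pw := s `^ _.
have pw0 : 0 <= pw by exact: powR_ge0.
have e1 : 1 <= expR 1 :> R by have := expR_ge1Dx (1 : R); lra.
have RHS0 : 0 <= (8 * expR 1) ^+ d * pw * norm2 (walsh_sum w).
  by rewrite !mulr_ge0 ?sqrtr_ge0 ?exprn_ge0 ?mulr_ge0 ?expR_ge0.
case: (leP b a) => [ba|ab]; first by lra.
(* With this [k], [r/k <= d] and [2k - 1 <= 2s]. *)
pose k := (Num.truncn (r / d%:R)).+1.
have [klo khi] : k%:R <= s /\ r / d%:R < k%:R.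
  have /andP[h1 h2] := truncn_itv rd0; split => //.
  by rewrite /k -natr1 /s; lra.
have k0 : 0 < k%:R :> R by rewrite ltr0n.
have := quantile_gap_sq d k r a b w d1 isT _ (ltW ab) wd qa qb.
rewrite -norm2_walsh_sum => /(_ ltac:(lra)).
set N := norm2 _ => gap.
have erk : expR (r / k%:R) <= expR 1 ^+ d.
  rewrite -expRM_natl mulr1 ler_expR ler_pdivrMr //.
  by move: khi; rewrite ltr_pdivrMr // mulrC => /ltW.
have kpow : k.*2.-1%:R ^+ d.-1 <= 2 ^+ d.-1 * s ^+ d.-1.
  rewrite -exprMn; apply: lerXn2r; rewrite ?nnegrE //; first by lra.
  apply: le_trans (_ : 2 * k%:R <= _); last by lra.
  by rewrite -natrM ler_nat mul2n leq_pred.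
(* The hypothesis [1 <= r] enters here: [d s = r + d <= (1 + d) r]. *)
have dle : d%:R * s <= 2 ^+ d * r.
  apply: le_trans (_ : (1 + d%:R) * r <= _).
    rewrite /s mulrDr mulrCA divff ?gt_eqF // mulr1 mulrDl mul1r; nra.
  apply: ler_wpM2r; first by lra.
  by rewrite -natrX nat1r ler_nat ltn_expl.
rewrite -(@ler_pXn2r _ 2) ?nnegrE //; last by lra.
have r0 : 0 < r by lra.
rewrite -(ler_pM2l r0); apply: le_trans gap _.
have sp : s ^+ d.-1 = pw ^+ 2 * s by rewrite powR_half_sqr.
have N0 : 0 <= N by exact: sqrtr_ge0.
have N2 : 0 <= N ^+ 2 by exact: sqr_ge0.
have E0 : 0 <= expR 1 :> R by exact: expR_ge0.
apply: le_trans (_ : 16 * expR 1 * (2 ^+ d.-1 * (pw ^+ 2 * s) * expR 1 ^+ d) * (d%:R * N ^+ 2) <= _).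
  apply: ler_wpM2r; first by apply: mulr_ge0; [exact: ltW | exact: N2].
  apply: ler_wpM2l; first by apply: mulr_ge0; [exact: ler0n | exact: E0].
  by apply: ler_pM; rewrite ?expR_ge0 ?exprn_ge0 // -sp.
rewrite [leLHS](_ : _ = 16 * expR 1 * 2 ^+ d.-1 * expR 1 ^+ d * pw ^+ 2 * N ^+ 2 * (d%:R * s)); last by ring.
apply: le_trans (_ : 16 * expR 1 * 2 ^+ d.-1 * expR 1 ^+ d * pw ^+ 2 * N ^+ 2 * (2 ^+ d * r) <= _).
  by apply: ler_wpM2l => //; rewrite !mulr_ge0 ?exprn_ge0.
rewrite [leLHS](_ : _ = r * (pw ^+ 2 * N ^+ 2) * (16 * 2 ^+ d.-1 * 2 ^+ d * (expR 1 * expR 1 ^+ d))); last by ring.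
rewrite [leRHS](_ : _ = r * (pw ^+ 2 * N ^+ 2) * (8 * expR 1) ^+ d ^+ 2); last by ring.
apply: ler_wpM2l; first by rewrite !mulr_ge0 ?sqr_ge0 // ltW.
have -> : ((8 * expR 1) ^+ d) ^+ 2 = 16 ^+ d * 2 ^+ d * 2 ^+ d * (expR 1 ^+ d * expR 1 ^+ d) :> R.
  by rewrite expr2 -!exprMn; congr (_ ^+ _); ring.
apply: ler_pM; rewrite ?mulr_ge0 ?exprn_ge0 //; last first.
  by apply: ler_wpM2r; rewrite ?exprn_ge0 // -[leLHS]expr1 ler_weXn2l.
apply: ler_wpM2r; rewrite ?exprn_ge0 //; apply: ler_pM; rewrite ?exprn_ge0 //.
  by rewrite -[leLHS]expr1 ler_weXn2l // ler1n.
by rewrite ler_weXn2l ?ler1n // leq_pred.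
Qed.
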